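(* Let $H$ be a complex Hilbert space and let $T \in \mathcal{L}(H)$ be a positive operator which satisfies property $\mathcal{AN}$. Then $T$ has the following representation $$T=\sum_{n\ge 1}\beta_n\,\upsilon_n\otimes\upsilon_n\;\oplus\; R_1,$$ where $\{\upsilon_n\}_{n=1}^\infty$ is an orthonormal sequence of vectors in $H$, $\beta_n\searrow\beta\ge 0$, and $\beta\ge\|R_1\|$.
   Context: $\mathcal{L}(H,J)$ denotes the bounded linear operators from a complex Hilbert space $H$ to a complex Hilbert space $J$, and $\mathcal{L}(H)=\mathcal{L}(H,H)$; here $R_1\in\mathcal{L}(H)$. ''Subspace'' always means closed subspace. An operator $P\in\mathcal{L}(H)$ is positive if $\langle Px,x\rangle\ge 0$ for all $x\in H$. For $\upsilon\in H$, $\upsilon\otimes\upsilon$ is the operator $x\mapsto\langle x,\upsilon\rangle\,\upsilon$; the series denotes the operator $x\mapsto\sum_{n\ge1}\beta_n\langle x,\upsilon_n\rangle\upsilon_n$. The notation $\beta_n\searrow\beta$ means that the real numbers $\beta_n$ satisfy $\beta_{n+1}\le\beta_n$ and converge to $\beta$. Two operators $T_1,T_2\in\mathcal{L}(H,J)$ are mutually orthogonal if $\langle T_1x,T_2y\rangle=0$ for all $x,y\in H$; in that case their sum is written $T_1\oplus T_2$. In the representation above, $\oplus$ is such a sum of the operator given by the whole series and $R_1$. An operator $T\in\mathcal{L}(H,J)$ satisfies property $\mathcal{N}$ if there is $x$ in the unit sphere of its domain (i.e. $\|x\|=1$) with $\|Tx\|=\|T\|$. $T\in\mathcal{L}(H,J)$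 satisfies property $\mathcal{AN}$ if for every closed subspace $M\subset H$, $M\ne\{0\}$, the restriction $T|_M$ satisfies property $\mathcal{N}$.
   Formalization: The infinite orthonormal sequence is asserted only when H is infinite-dimensional, since none exists otherwise (e.g. H = C, T = I); for finite-dimensional H the representation uses a finite orthonormal basis with nonincreasing β_n ≥ 0 and R_1 = 0. *)

(* Defs.v *)
From mathcomp Require Import all_boot all_order all_algebra.
From mathcomp Require Import complex.
From mathcomp Require Import all_classical all_reals all_analysis.

Set Implicit Arguments.
Unset Strict Implicit.
Unset Printing Implicit Defensive.

Import Order.TTheory GRing.Theory Num.Theory.
Import numFieldNormedType.Exports.

Local Open Scope classical_set_scope.
Local Open Scope ring_scope.
Local Open Scope complex_scope.

(* A complex Hilbert space is a complete normed module over R[i] together with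
   an inner product, linear in the first argument, that induces its norm. *)
Definition induces_norm (R : realType) (H : completeNormedModType R[i])
    (dot : {dot H for Num.conj}) : Prop :=
  forall x : H, `|x| ^+ 2 = dot x x.

(* Norms take values in R[i]; [rnorm] is the same number seen in R. *)
Definition rnorm (R : realType) (H : normedModType R[i]) (x : H) : R :=
  complex.Re `|x|.

Definition closed_subspace (R : realType) (H : normedModType R[i])
    (M : set H) : Prop :=
  [/\ closed M, M 0 & forall (a : R[i]) (x y : H), M x -> M y -> M (a *: x + y)].

Definition bounded_op (R : realType) (H J : normedModType R[i])
    (T : {linear H -> J}) : Prop :=
  bounded_near T (nbhs (0 : H)).

(* The operator norm of the restriction of T to the subspace M.  The supremum is
   the true one when T is bounded ([sup] is 0 on unbounded sets). *)
Definition opnorm_on (R : realType) (H J : normedModType R[i]) (M : set H)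
    (T : H -> J) : R :=
  sup [set rnorm (T x) | x in [set x | M x /\ rnorm x <= 1]].

Definition opnorm (R : realType) (H J : normedModType R[i]) (T : H -> J) : R :=
  opnorm_on setT T.

(* Property N for the restriction of T to M; property N for T is the case
   M = setT. *)
Definition property_N_on (R : realType) (H J : normedModType R[i]) (M : set H)
    (T : H -> J) : Prop :=
  exists x : H, [/\ M x, rnorm x = 1 & rnorm (T x) = opnorm_on M T].

Definition property_AN (R : realType) (H J : normedModType R[i])
    (T : H -> J) : Prop :=
  forall M : set H,
    closed_subspace M -> M <> [set 0] -> property_N_on M T.

(* In R[i], [0 <= z] says that z is real and nonnegative. *)
Definition positive_op (R : realType) (H : normedModType R[i])
    (dot : H -> H -> R[i]) (T : H -> H) : Prop :=
  forall x : H, 0 <= dot (T x) x.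

Definition orthonormal_family (R : realType) (H : normedModType R[i])
    (dot : H -> H -> R[i]) (I : eqType) (v : I -> H) : Prop :=
  forall i j : I, dot (v i) (v j) = (i == j)%:R.

Definition mutually_orthogonal (R : realType) (H J : normedModType R[i])
    (dotJ : J -> J -> R[i]) (T1 T2 : H -> J) : Prop :=
  forall x y : H, dotJ (T1 x) (T2 y) = 0.

Definition rank_one (R : realType) (H : normedModType R[i])
    (dot : H -> H -> R[i]) (v : H) : H -> H :=
  fun x => dot x v *: v.

(* S is the sum of the series of operators beta_n v_n (x) v_n, in the pointwise
   (strong) sense. *)
Definition op_series_sum (R : realType) (H : normedModType R[i])
    (dot : H -> H -> R[i]) (beta : nat -> R) (v : nat -> H)
    (S : H -> H) : Prop :=
  forall x : H,
    series (fun n => (beta n)%:C *: rank_one dot (v n) x) @ \oo --> S x.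

Definition finite_dimensional (R : realType) (H : normedModType R[i]) : Prop :=
  exists (d : nat) (e : 'I_d -> H),
    forall x : H, exists c : 'I_d -> R[i], x = \sum_(i < d) c i *: e i.

(* An infinite orthonormal sequence: indices start at 0 rather than 1. *)
Definition AN_representation (R : realType) (H : completeNormedModType R[i])
    (dot : {dot H for Num.conj}) (T : {linear H -> H}) : Prop :=
  exists (v : nat -> H) (beta : nat -> R) (b : R) (S R1 : {linear H -> H}),
    [/\ orthonormal_family dot v,
        [/\ nonincreasing_seq beta, beta @ \oo --> b & 0 <= b],
        [/\ bounded_op S, op_series_sum dot beta v S & bounded_op R1],
        mutually_orthogonal dot S R1 /\ (forall x : H, T x = S x + R1 x) &
        opnorm R1 <= b].

(* The same representation when H has finite dimension d: the orthonormal
   sequence stops when it exhausts H, and nothing is left for R1. *)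
Definition AN_representation_findim (R : realType)
    (H : completeNormedModType R[i]) (dot : {dot H for Num.conj})
    (T : {linear H -> H}) : Prop :=
  exists (d : nat) (v : 'I_d -> H) (beta : 'I_d -> R),
    [/\ orthonormal_family dot v,
        forall x : H, x = \sum_(i < d) rank_one dot (v i) x,
        forall i j : 'I_d, (i <= j)%N -> beta j <= beta i,
        forall i : 'I_d, 0 <= beta i &
        forall x : H, T x = \sum_(i < d) (beta i)%:C *: rank_one dot (v i) x].

(* Main.v *)
(* Greedy diagonalisation.  If M is a nonzero closed T-invariant subspace and
   the unit vector x of M satisfies |T x| = ||T|_M|| = b, then positivity forces
   T x = b x.  Apply this to M = H, then to the orthogonal complement of the
   eigenvectors already found, and so on.  If the process exhausts H, then H is
   finite-dimensional and T is diagonal.  Otherwise it yields an orthonormal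
   sequence v_n with nonincreasing eigenvalues; with P the orthogonal projection
   onto the closed span of the v_n, take S = T P and R1 = T (1 - P).  Each
   x - P x lies in every complement, so |R1 x| <= beta_n |x| for all n. *)

From HB Require Import structures.
Require Import Defs.
From mathcomp Require Import all_boot all_order all_algebra.
From mathcomp Require Import complex.
From mathcomp Require Import ring.
From mathcomp Require Import all_classical all_reals all_analysis.

Set Implicit Arguments.
Unset Strict Implicit.
Unset Printing Implicit Defensive.

Import Order.TTheory GRing.Theory Num.Theory.
Import numFieldNormedType.Exports.

Local Open Scope classical_set_scope.
Local Open Scope ring_scope.

(** * Choosing a sequence along its own history *)

Lemma mem_mkseqP (A : eqType) (f : nat -> A) n y :
  reflect (exists2 i, (i < n)%N & y = f i) (y \in mkseq f n).
Proof.
by apply: (iffP mapP) => -[k]; rewrite ?mem_iota => ? ->; exists k;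
  rewrite ?mem_iota.
Qed.

(** Dependent choice with full memory: a greedy vector must be orthogonal to all earlier ones, so it
    is picked from the list of its predecessors, which is [sq n] in the proof. *)
Lemma history_choice (A : choiceType) (P : seq A -> A -> Prop) :
  (forall s, exists x, P s x) ->
  exists v : nat -> A, forall n, P (mkseq v n) (v n).
Proof.
move=> /choice[f Pf]; pose sq := fix sq n :=
  if n is m.+1 then rcons (sq m) (f (sq m)) else [::].
exists (f \o sq) => n.
suff -> : mkseq (f \o sq) n = sq n by exact: Pf.
by elim: n => //= n IHn; rewrite mkseqS IHn.
Qed.

(** * Real-valued norms and bounded operators *)

Section RealNorm.
Context {R : realType} {H : normedModType R[i]}.
Implicit Types x y : H.

Lemma rnormE x : `|x| = (rnorm x)%:C%C.
Proof. by rewrite /rnorm RRe_real // ger0_real. Qed.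

Lemma rnorm_ge0 x : 0 <= rnorm x.
Proof. by rewrite -ler0c -rnormE. Qed.

Lemma rnorm_eq0 x : (rnorm x == 0) = (x == 0).
Proof.
by rewrite -[RHS]normr_eq0 rnormE (inj_eq (@complexI R) (rnorm x) 0).
Qed.

Lemma rnorm0 : rnorm (0 : H) = 0.
Proof. by apply/eqP; rewrite rnorm_eq0. Qed.

Lemma rnormZ (a : R) x : 0 <= a -> rnorm (a%:C%C *: x) = a * rnorm x.
Proof.
move=> a0; apply: (@complexI R).
by rewrite -rnormE normrZ ger0_norm ?ler0c// rnormE rmorphM.
Qed.

End RealNorm.

Lemma bounded_op_rnormP (R : realType) (H J : normedModType R[i])
    (T : {linear H -> J}) :
  bounded_op T <-> exists2 K, 0 <= K & forall x, rnorm (T x) <= K * rnorm x.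
Proof.
rewrite /bounded_op linear_boundedP; split.
- case=> M [Mreal hM].
  (* Every constant strictly above [M] is a bound, but [M] may be negative; the absolute value and
     the [+ 1] yield a nonnegative one. *)
  pose K : R := `|complex.Re M| + 1.
  have K0 : 0 <= K by rewrite addr_ge0.
  have MK : M < K%:C%C by rewrite -(RRe_real Mreal) ltcR ltr_pwDr// ler_norm.
  exists K => // x; have := hM _ MK x.
  by rewrite !rnormE -rmorphM lecR.
- case=> K K0 TK; exists K%:C%C; split; first by rewrite ger0_real ?ler0c.
  move=> r Kr x; rewrite (le_trans _ (ler_wpM2r (normr_ge0 x) (ltW Kr)))//.
  by rewrite !rnormE -rmorphM lecR.
Qed.

(** * Inner product geometry and self-adjointness *)

Section InnerProduct.
Context {R : realType} {H : completeNormedModType R[i]}.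
Context {dot : {dot H for Num.conj}}.
Hypothesis dot_norm : induces_norm dot.
Implicit Types x y z : H.

Lemma dotC x y : dot x y = (dot y x)^*.
Proof. by rewrite [LHS]hermC mul1r. Qed.

Lemma dotZr a x y : dot x (a *: y) = a^* * dot x y.
Proof. by rewrite linearZr_LR. Qed.

Lemma dot_eq0C x y : dot x y = 0 -> dot y x = 0.
Proof. by move=> xy; rewrite dotC xy rmorph0. Qed.

Lemma dotxx x : dot x x = (rnorm x ^+ 2)%:C%C.
Proof. by rewrite -dot_norm rnormE rmorphXn. Qed.

Lemma rnormD_orth x y :
  dot x y = 0 -> rnorm (x + y) ^+ 2 = rnorm x ^+ 2 + rnorm y ^+ 2.
Proof.
move=> xy; apply: (@complexI R); rewrite rmorphD/= -!dotxx.
by rewrite linearDl !linearDr /= xy (dot_eq0C xy) addr0 add0r.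
Qed.

(** Split off from [x] its projection [a *: y] on [y]. Pythagoras gives [|a *: y| <= |x|], which is
    the claim divided by [|y|]. *)
Lemma CauchySchwarz x y : `|dot x y| <= `|x| * `|y|.
Proof.
have [->|y0] := eqVneq y 0; first by rewrite linear0r !normr0 mulr0.
have ny : 0 < `|y| by rewrite normr_gt0.
pose a := dot x y / `|y| ^+ 2.
have xy : dot (x - a *: y) y = 0.
  rewrite linearBl linearZl_LR /= -dot_norm /a.
  by rewrite divfK ?subrr ?expf_neq0 ?gt_eqF.
have : `|a *: y| ^+ 2 <= `|x| ^+ 2.
  rewrite -[x in leRHS](subrK (a *: y)) !rnormE -!rmorphXn lecR.
  by rewrite rnormD_orth ?dotZr ?xy ?mulr0// lerDr sqr_ge0.
rewrite ler_pXn2r ?nnegrE// normrZ /a normrM normfV normrX normr_id expr2 invfM.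
by rewrite mulrA divfK ?gt_eqF// ler_pdivrMr.
Qed.

Lemma dotl_continuous y : continuous (dot ^~ y).
Proof.
move=> x; apply/cvgrPdist_lt => e e0.
near=> z; rewrite -[ltLHS]/`|dot x y - dot z y| -linearBl.
apply: le_lt_trans (CauchySchwarz (x - z) y) _.
(* The [+ 1] keeps the denominator positive when [y = 0]. *)
suff : `|x - z| < e / (`|y| + 1).
  rewrite ltr_pdivlMr ?ltr_pwDr// => /(le_lt_trans _); apply.
  by rewrite ler_wpM2l// lerDl.
near: z; apply: (@cvgr_dist_lt _ _ _ _ _ id) => //.
by rewrite divr_gt0// ltr_pwDr.
Unshelve. all: by end_near. Qed.

Lemma cvg_dotl I (F : set_system I) {FF : Filter F} (f : I -> H) x y :
  f @ F --> x -> dot (f i) y @[i --> F] --> dot x y.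
Proof.
move=> fx; apply: (@cvg_comp _ _ _ f (dot ^~ y) _ _ _ fx).
exact: dotl_continuous.
Qed.

Lemma rnorm_sum_orth (I : eqType) (r : seq I) (u : I -> H) :
  uniq r -> (forall i j, i \in r -> j \in r -> i != j -> dot (u i) (u j) = 0) ->
  rnorm (\sum_(i <- r) u i) ^+ 2 = \sum_(i <- r) rnorm (u i) ^+ 2.
Proof.
elim: r => [|i r IHr] /=; first by rewrite !big_nil rnorm0 expr0n.
move=> /andP[ir ur] or; rewrite !big_cons rnormD_orth ?IHr//.
  by move=> j k jr kr; apply: or; rewrite in_cons ?jr ?kr orbT.
rewrite linear_sumr big_seq big1// => j jr; apply: or; rewrite ?mem_head//.
  by rewrite in_cons jr orbT.
by apply: contraNneq ir => ->.
Qed.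

Section PositiveOperator.
Variable T : {linear H -> H}.
Hypothesis T_positive : positive_op dot T.

(** Polarisation over the complex scalars: the defect [D] vanishes on the diagonal because
    [dot (T a) a] is real, so it is antisymmetric. Replacing [y] by ['i *: y] makes it symmetric as
    well, hence zero. *)
Lemma positive_selfadjoint x y : dot (T x) y = dot x (T y).
Proof.
pose D a b := dot (T a) b - dot a (T b).
have D0 a : D a a = 0.
  by rewrite /D [X in _ - X]dotC (geC0_conj (T_positive a)) subrr.
have D1 a b : D a b + D b a = 0.
  have := D0 (a + b); rewrite /D linearD !linearDl !linearDr /=.
  have /subr0_eq -> := D0 a; have /subr0_eq -> := D0 b.
  by move=> <-; ring.
have D2 : D x y = D y x.
  have := D1 x ('i *: y).
  rewrite /D [T ('i *: y)]linearZ /= !linearZl_LR /= !dotZr -!mulrBr conjCi.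
  rewrite mulNr addrC => /eqP.
  by rewrite subr_eq0 => /eqP /(mulfI (neq0Ci _)).
have := D1 x y; rewrite -D2 => /eqP.
by rewrite -mulr2n mulrn_eq0 /= subr_eq0 => /eqP.
Qed.
End PositiveOperator.
End InnerProduct.

(** * Restricted norms and maximal eigenvectors *)

Lemma rnorm_le_opnorm_on (R : realType) (H J : normedModType R[i])
    (T : {linear H -> J}) (M : set H) z :
  bounded_op T -> closed_subspace M -> M z ->
  rnorm (T z) <= opnorm_on M T * rnorm z.
Proof.
move=> /bounded_op_rnormP[K K0 TK] [_ M0 Mlin] Mz.
have [->|z0] := eqVneq z 0; first by rewrite linear0 !rnorm0 mulr0.
have nz : 0 < rnorm z by rewrite lt_def rnorm_eq0 z0 rnorm_ge0.
pose a := (rnorm z)^-1; have a0 : 0 <= a by rewrite invr_ge0 ltW.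
rewrite -ler_pdivrMr// mulrC -[_ * _]/(a * _) -rnormZ// -linearZ.
apply: sup_upper_bound.
  (* The supremum bounds the set only if the set is nonempty and bounded above; [T_bounded]-type
     control by [K] supplies the latter. *)
  split; first by exists (rnorm (T 0)); exists 0; rewrite //= rnorm0.
  exists K => _ [x [_ x1] <-].
  by rewrite (le_trans (TK x))// ler_piMr.
exists (a%:C%C *: z) => //; split; first by rewrite -[_ *: _]addr0; exact: Mlin.
by rewrite rnormZ// /a mulVf// gt_eqF.
Qed.

Section AN.
Context {R : realType} {H : completeNormedModType R[i]}.
Context {dot : {dot H for Num.conj}}.
Hypothesis dot_norm : induces_norm dot.
Variable T : {linear H -> H}.
Hypothesis T_positive : positive_op dot T.
Implicit Types (x y z : H) (s : seq H) (v : nat -> H).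

Lemma eigen_of_max (M : set H) (b : R) x :
  (forall z, M z -> M (T z)) ->
  (forall z, M z -> rnorm (T z) <= b * rnorm z) ->
  M x -> rnorm x = 1 -> rnorm (T x) = b -> T x = b%:C%C *: x.
Proof.
move=> MT Tb Mx x1 Txb.
have b0 : 0 <= b by rewrite -Txb rnorm_ge0.
(* Expanding |T^2 x - b^2 x|^2 with <T^2 x, x> = |T x|^2 = b^2 gives
   |T^2 x|^2 - b^4 <= 0. *)
have TTx : T (T x) = (b ^+ 2)%:C%C *: x.
  apply/eqP; rewrite -subr_eq0 -rnorm_eq0 -sqrf_eq0 eq_le sqr_ge0 andbT.
  have -> : rnorm (T (T x) - (b ^+ 2)%:C%C *: x) ^+ 2 =
            rnorm (T (T x)) ^+ 2 - (b * b) ^+ 2.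
    have TTxx : dot (T (T x)) x = (b ^+ 2)%:C%C.
      by rewrite (positive_selfadjoint T_positive) (dotxx dot_norm) Txb.
    have conjb : (b ^+ 2)%:C%C ^* = (b ^+ 2)%:C%C.
      by rewrite conj_Creal// ger0_real// ler0c sqr_ge0.
    apply: (@complexI R); rewrite -(dotxx dot_norm) linearBl !linearBr /=.
    rewrite !linearZl_LR /= !dotZr [dot x _]dotC TTxx conjb.
    rewrite !(dotxx dot_norm) x1.
    by rewrite !(rmorphB, rmorphM, rmorphXn, rmorph1) /=; ring.
  rewrite subr_le0 ler_pXn2r ?nnegrE ?rnorm_ge0 ?mulr_ge0//.
  by rewrite -{2}Txb; apply/Tb/MT.
(* The sign argument below divides by [b]; for [b = 0] the vector [T x] already has norm zero. *)
have [b_eq0|b_neq0] := eqVneq b 0.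
  by apply/eqP; rewrite b_eq0 scale0r -rnorm_eq0 Txb b_eq0.
(* (T + b)(T - b) x = 0, and T has no negative eigenvalue. *)
pose y := T x - b%:C%C *: x.
have Ty : T y = - (b%:C%C *: y).
  by rewrite /y linearB linearZ /= TTx scalerBr scalerA -rmorphM opprB expr2.
have := T_positive y.
rewrite Ty linearNl linearZl_LR /= (dotxx dot_norm) -rmorphM -rmorphN.
rewrite ler0c oppr_ge0 pmulr_rle0 ?lt_def ?b_neq0// => y2.
apply/eqP; rewrite -subr_eq0 -/y -rnorm_eq0 -sqrf_eq0.
by rewrite eq_le y2 sqr_ge0.
Qed.

Definition orth s : set H := [set x | {in s, forall y, dot x y = 0}].

Lemma closed_subspace_orth s : closed_subspace (orth s).
Proof.
split.
- have -> : orth s = \bigcap_(y in [set` s]) (dot ^~ y @^-1` [set 0]).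
    by apply/seteqP; split => x /= xs y /xs.
  apply: closed_bigI => y _; apply: closed_comp.
    by move=> x _; apply: dotl_continuous.
  exact/accessible_closed_set1/hausdorff_accessible/norm_hausdorff.
- by move=> y _; rewrite linear0l.
- move=> a x y xs ys z zs.
  by rewrite linearDl linearZl_LR /= xs// ys// mulr0 addr0.
Qed.

(** Self-adjointness moves [T] onto the eigenvector [y], where it only contributes a scalar. *)
Lemma orth_invariant s z :
  {in s, forall y, exists c, T y = c *: y} -> orth s z -> orth s (T z).
Proof.
move=> eig zs y ys; have [c Ty] := eig y ys.
by rewrite (positive_selfadjoint T_positive) Ty dotZr zs// mulr0.
Qed.

Hypothesis T_bounded : bounded_op T.
Hypothesis T_AN : property_AN T.

(** The eigenvalue is encoded as [rnorm (T x)], so that it is real and nonnegative by construction;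
    the last clause makes it the norm of [T] on [orth s]. *)
Definition max_eigenvector s x :=
  [/\ orth s x, rnorm x = 1, T x = (rnorm (T x))%:C%C *: x &
      forall z, orth s z -> rnorm (T z) <= rnorm (T x) * rnorm z].

Lemma exists_max_eigenvector s :
  {in s, forall y, exists c, T y = c *: y} -> orth s <> [set 0] ->
  exists x, max_eigenvector s x.
Proof.
move=> eig s0; have sub_s := closed_subspace_orth s.
have [x [xs x1 Tx]] := T_AN sub_s s0.
have Tmax z : orth s z -> rnorm (T z) <= rnorm (T x) * rnorm z.
  by move=> zs; rewrite Tx; exact: rnorm_le_opnorm_on.
exists x; split=> //; apply: (@eigen_of_max (orth s)) => //.
by move=> z; exact: orth_invariant.
Qed.

(** The condition is imposed for each [n] separately, so that a single total sequence serves both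
    outcomes: the process stops or runs forever. *)
Lemma exists_max_eigenvectors : exists v, forall n,
  orth (mkseq v n) <> [set 0] -> max_eigenvector (mkseq v n) (v n).
Proof.
(* Choice needs a vector for every list; 0 is a dummy value where a premise fails. *)
have step s : exists x, {in s, forall y, exists c, T y = c *: y} ->
    orth s <> [set 0] -> max_eigenvector s x.
  have [eig|] := pselect {in s, forall y, exists c, T y = c *: y}; last first.
    by exists 0.
  have [|s0] := pselect (orth s = [set 0]); first by exists 0.
  by have [x ?] := exists_max_eigenvector eig s0; exists x.
have [v vP] := history_choice step; exists v.
elim/ltn_ind => n IHn n0; apply: vP => // y /mem_mkseqP[i i_n ->].
exists (rnorm (T (v i)))%:C%C.
have [|_ _ Tvi _] := IHn i i_n; last exact: Tvi.
(* Complements shrink as the list grows: a trivial one at stage [i < n] would be trivial at stage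
   [n] too. *)
apply: contra_not n0 => i0; apply/seteqP; split => [x xn|_ ->]; last first.
  by have [] := closed_subspace_orth (mkseq v n).
rewrite -i0 => _ /mem_mkseqP[j j_i ->].
by apply: xn; apply/mem_mkseqP; exists j; rewrite ?(ltn_trans j_i).
Qed.

End AN.

(** * Orthonormal families and the projection onto their closed span *)

Section Orthonormal.
Context {R : realType} {H : completeNormedModType R[i]}.
Context {dot : {dot H for Num.conj}}.
Hypothesis dot_norm : induces_norm dot.
Implicit Types x y : H.

Section Family.
Context {I : eqType} {v : I -> H}.
Hypothesis v_orthonormal : orthonormal_family dot v.

Lemma dot_rank_oneE i j x y :
  dot (rank_one dot (v i) x) (rank_one dot (v j) y) =
  (i == j)%:R * (dot x (v i) * (dot y (v j))^*).
Proof.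
by rewrite /rank_one linearZl_LR /= dotZr v_orthonormal; ring.
Qed.

Lemma dot_sum_rank_one (r : seq I) x j : uniq r -> j \in r ->
  dot (\sum_(i <- r) rank_one dot (v i) x) (v j) = dot x (v j).
Proof.
move=> r_uniq jr; rewrite linear_sumlz (bigD1_seq j)//= big1 => [|i /negPf ij].
  by rewrite addr0 linearZl_LR /= v_orthonormal eqxx mulr1.
by rewrite linearZl_LR /= v_orthonormal ij mulr0.
Qed.

Lemma rnorm_sum_rank_one (r : seq I) x : uniq r ->
  rnorm (\sum_(i <- r) rank_one dot (v i) x) ^+ 2 =
  \sum_(i <- r) rnorm (rank_one dot (v i) x) ^+ 2.
Proof.
move=> r_uniq; apply: (rnorm_sum_orth dot_norm) => // i j _ _ /negPf ij.
by rewrite dot_rank_oneE ij mul0r.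
Qed.

(** Pythagoras for the partial sum [p] and the remainder [x - p], which is orthogonal to every term
    of [p]. *)
Lemma Bessel (r : seq I) x : uniq r ->
  \sum_(i <- r) rnorm (rank_one dot (v i) x) ^+ 2 <= rnorm x ^+ 2.
Proof.
move=> r_uniq; rewrite -rnorm_sum_rank_one//.
set p := \sum_(i <- r) _; rewrite -[in leRHS](subrK p x) addrC.
rewrite (rnormD_orth dot_norm) ?lerDl ?sqr_ge0//; apply: dot_eq0C.
rewrite linear_sumr big_seq big1// => i ir.
by rewrite /rank_one /= dotZr linearBl /= dot_sum_rank_one// subrr mulr0.
Qed.

End Family.

(** A row relation of the coefficient matrix [A] is a linear relation among the [v i], and pairing
    it with [v k] kills its [k]-th coefficient. So [A] has full row rank [n], at most its number [d]
    of columns. *)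
Lemma orthonormal_le_dim n d (v : 'I_n -> H) (e : 'I_d -> H) :
  orthonormal_family dot v ->
  (forall x, exists c : 'I_d -> R[i], x = \sum_(i < d) c i *: e i) ->
  (n <= d)%N.
Proof.
move=> v_on e_span; have [c cE] := choice (fun i => e_span (v i)).
pose A := \matrix_(i, j) c i j.
suff : row_free A by rewrite /row_free => /eqP <-; exact: rank_leq_col.
apply: inj_row_free => u uA; apply/rowP => k; rewrite mxE.
have u0 : \sum_(i < n) u 0 i *: v i = 0.
  under eq_bigr do rewrite cE scaler_sumr.
  rewrite exchange_big big1//= => j _; under eq_bigr do rewrite scalerA.
  rewrite -scaler_suml; move/rowP/(_ j): uA; rewrite !mxE.
  by under eq_bigr do rewrite mxE; move=> ->; rewrite scale0r.
have := linear0l dot (v k); rewrite -u0 linear_sumlz (bigD1 k)//=.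
rewrite big1 => [|i /negPf ik].
  by rewrite addr0 linearZl_LR /= v_on eqxx mulr1.
by rewrite linearZl_LR /= v_on ik mulr0.
Qed.

Section Sequence.
Context {v : nat -> H}.
Hypothesis v_orthonormal : orthonormal_family dot v.

(** By Bessel the real series of squared norms converges. Pythagoras equates its blocks with the
    squared norms of the blocks of the vector series, so the Cauchy criterion carries over. *)
Lemma orthonormal_series_cvg x :
  cvgn (series (fun k => rank_one dot (v k) x)).
Proof.
pose a k : R := rnorm (rank_one dot (v k) x) ^+ 2.
have a_ge0 k : 0 <= a k by rewrite sqr_ge0.
have a_cvg : cvgn (series a).
  apply: nondecreasing_is_cvgn; first exact: nondecreasing_series.
  exists (rnorm x ^+ 2) => _ [n _ <-].
  by rewrite seriesEnat /=; apply: (Bessel v_orthonormal); exact: iota_uniq.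
have /cauchy_cvgP /(@cauchy_seriesP _ R^o) a_cauchy := a_cvg.
apply/cauchy_cvgP/cauchy_seriesP => e e0.
have eE : (complex.Re e)%:C%C = e by rewrite RRe_real// gtr0_real.
have r0 : 0 < complex.Re e by rewrite -ltcR eE.
(* The tolerance is squared because [a] sums squared norms. *)
have := a_cauchy _ (exprn_gt0 2 r0); apply: filterS => -[m n] /=.
rewrite ger0_norm ?sumr_ge0// -(rnorm_sum_rank_one v_orthonormal) ?iota_uniq//.
rewrite ltr_pXn2r ?nnegrE ?rnorm_ge0 ?(ltW r0)// => mn.
by rewrite rnormE -eE ltcR.
Qed.

(** The orthogonal projection onto the closed span of the [v k]; [orthonormal_series_cvg] ensures
    that the limit is genuine. *)
Definition span_proj x := limn (series (fun k => rank_one dot (v k) x)).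

Lemma cvg_span_proj x :
  series (fun k => rank_one dot (v k) x) @ \oo --> span_proj x.
Proof. exact: orthonormal_series_cvg. Qed.

Lemma span_proj_linear : linear span_proj.
Proof.
move=> a x y; apply/cvg_lim; first exact: norm_hausdorff.
have -> : series (fun k => rank_one dot (v k) (a *: x + y)) =
    a \*: series (fun k => rank_one dot (v k) x) +
    series (fun k => rank_one dot (v k) y).
  apply/funext => n.
  rewrite -[RHS]/(a *: \sum_(0 <= k < n) rank_one dot (v k) x +
                  \sum_(0 <= k < n) rank_one dot (v k) y).
  rewrite seriesEnat /= scaler_sumr -big_split /=.
  apply: eq_bigr => k _.
  by rewrite /rank_one linearDl linearZl_LR /= scalerDl scalerA.
apply: cvgD; last exact: cvg_span_proj.
by apply: cvgZl_tmp; exact: cvg_span_proj.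
Qed.

Definition span_projL : {linear H -> H} := HB.pack span_proj
  (GRing.isLinear.Build R[i] H H *:%R span_proj span_proj_linear).

(** By continuity of [dot], inner products with the projection can be read off partial sums as soon
    as these stabilise. *)
Lemma dot_span_proj_near x y c :
  (\forall n \near \oo,
     dot (series (fun k => rank_one dot (v k) x) n) y = c) ->
  dot (span_proj x) y = c.
Proof.
move=> /cvg_near_cst; apply: cvg_unique; first exact: norm_hausdorff.
by apply: (cvg_dotl dot_norm); exact: cvg_span_proj.
Qed.

Lemma dot_span_proj x j : dot (span_proj x) (v j) = dot x (v j).
Proof.
(* The [n]-th partial sum runs over [k < n], so index [j] is present from [j.+1] on. *)
apply: dot_span_proj_near; exists j.+1 => // n /= jn.
by rewrite seriesEnat /= dot_sum_rank_one// ?iota_uniq// mem_index_iota.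
Qed.

Lemma span_proj_orth x y :
  (forall j, dot y (v j) = 0) -> dot (span_proj x) y = 0.
Proof.
move=> yv; apply: dot_span_proj_near; apply: nearW => n.
rewrite seriesEnat /= linear_sumlz big1// => k _.
by rewrite linearZl_LR /= (dot_eq0C (yv k)) mulr0.
Qed.

Lemma dot_sub_span_proj x j : dot (x - span_proj x) (v j) = 0.
Proof. by rewrite linearBl /= dot_span_proj subrr. Qed.

Lemma rnorm_span_proj x :
  rnorm x ^+ 2 = rnorm (span_proj x) ^+ 2 + rnorm (x - span_proj x) ^+ 2.
Proof.
rewrite -[in LHS](addrNK (span_proj x) x) [in LHS]addrC.
apply: (rnormD_orth dot_norm).
by apply: span_proj_orth => j; exact: dot_sub_span_proj.
Qed.

End Sequence.
End Orthonormal.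

(** * From greedy eigenvectors to the representations *)

Section Greedy.
Context {R : realType} {H : completeNormedModType R[i]}.
Context {dot : {dot H for Num.conj}}.
Hypothesis dot_norm : induces_norm dot.
Variable T : {linear H -> H}.
Variable v : nat -> H.
Implicit Types x y z : H.

Local Notation greedy n := (max_eigenvector (dot := dot) T (mkseq v n) (v n)).
Local Notation beta n := (rnorm (T (v n))).

Lemma greedy_orthonormal i j :
  greedy i -> greedy j -> dot (v i) (v j) = (i == j)%:R.
Proof.
move=> [vi ni _ _] [vj nj _ _]; case: ltngtP => [ij|ji|<-].
- by apply/dot_eq0C/vj/mem_mkseqP; exists i.
- by apply/vi/mem_mkseqP; exists j.
- by rewrite (dotxx dot_norm) ni expr1n.
Qed.

(** The later vector [v j] also lies in the larger complement on which [v i] is maximal. *)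
Lemma greedy_nonincreasing i j :
  (i <= j)%N -> greedy i -> greedy j -> beta j <= beta i.
Proof.
move=> ij [_ _ _ maxi] [vj nj _ _].
rewrite -[leRHS]mulr1 -nj; apply: maxi => _ /mem_mkseqP[k ki ->].
by apply/vj/mem_mkseqP; exists k => //; exact: leq_trans ij.
Qed.

Lemma AN_representation_findim_of_greedy n :
  (forall i, (i < n)%N -> greedy i) ->
  orth (dot := dot) (mkseq v n) = [set 0] ->
  finite_dimensional H /\ AN_representation_findim dot T.
Proof.
move=> g n0; pose w (i : 'I_n) := v i.
have w_on : orthonormal_family dot w.
  by move=> i j; rewrite greedy_orthonormal//; exact: g.
have xE x : x = \sum_(i < n) rank_one dot (w i) x.
  apply/eqP; rewrite -subr_eq0; apply/eqP.
  (* The remainder is orthogonal to all the [v k], so it lies in the trivial complement. For [n = 0]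
     this says that [H] is zero. *)
  suff : [set 0] (x - \sum_(i < n) rank_one dot (w i) x) by [].
  rewrite -n0 => _ /mem_mkseqP[k kn ->].
  rewrite linearBl /= -[v k]/(w (Ordinal kn)) (dot_sum_rank_one w_on).
  - by rewrite subrr.
  - exact: index_enum_uniq.
  - exact: mem_index_enum.
split; first by exists n, w => x; exists (fun i => dot x (w i)); exact: xE.
exists n, w, (fun i => rnorm (T (w i))); split => // [i j ij|i|x].
- by apply: greedy_nonincreasing => //; exact: g.
- exact: rnorm_ge0.
- rewrite [in LHS](xE x) linear_sum; apply: eq_bigr => i _.
  have [_ _ Tw _] := g i (ltn_ord i).
  by rewrite /rank_one linearZ /= [in LHS]Tw !scalerA mulrC.
Qed.

Hypothesis T_bounded : bounded_op T.
Hypothesis T_positive : positive_op dot T.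

Lemma AN_representation_of_greedy :
  (forall n, greedy n) -> AN_representation dot T.
Proof.
move=> g; have v_on : orthonormal_family dot v.
  by move=> i j; exact: greedy_orthonormal.
have [K K0 TK] := (bounded_op_rnormP T).1 T_bounded.
pose P := span_projL dot_norm v_on.
have P_le x : rnorm (P x) <= rnorm x.
  rewrite -(ler_pXn2r (ltn0Sn 1)) ?nnegrE ?rnorm_ge0//.
  by rewrite (rnorm_span_proj dot_norm v_on x) lerDl sqr_ge0.
have Q_le x : rnorm (x - P x) <= rnorm x.
  rewrite -(ler_pXn2r (ltn0Sn 1)) ?nnegrE ?rnorm_ge0//.
  by rewrite (rnorm_span_proj dot_norm v_on x) lerDr sqr_ge0.
have Qv x k : dot (x - P x) (v k) = 0.
  exact: (dot_sub_span_proj dot_norm v_on).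
have beta_ni : nonincreasing_seq (fun n => beta n).
  by move=> i j ij; apply: greedy_nonincreasing.
have beta_cvg : cvgn (fun n => beta n).
  apply: nonincreasing_is_cvgn => //.
  by exists 0 => _ [n _ <-]; exact: rnorm_ge0.
have QP : linear (fun x => x - P x).
  by move=> a x y; rewrite linearP /= scalerBr opprD addrACA.
pose Q : {linear H -> H} := HB.pack (fun x => x - P x)
  (GRing.isLinear.Build R[i] H H *:%R _ QP).
exists v, (fun n => beta n), (limn (fun n => beta n)), (T \o P), (T \o Q).
have TQ_le n x : rnorm (T (Q x)) <= beta n * rnorm x.
  have [_ _ _ maxn] := g n.
  apply: le_trans (maxn (Q x) _) _; last first.
    by apply: ler_wpM2l; [exact: rnorm_ge0|exact: Q_le].
  by move=> _ /mem_mkseqP[k _ ->]; exact: Qv.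
split => //.
- split => //; apply: limr_ge => //; apply: nearW => n; exact: rnorm_ge0.
- split.
  + apply/bounded_op_rnormP; exists K => // x /=.
    by apply: le_trans (TK _) _; apply: ler_wpM2l => //; exact: P_le.
  + move=> x.
    (* On partial sums [T] acts as multiplication by the eigenvalues; its continuity then carries
       this to the limit. *)
    have -> : series (fun n => (beta n)%:C%C *: rank_one dot (v n) x) =
        T \o series (fun n => rank_one dot (v n) x).
      apply/funext => n; rewrite /= !seriesEnat /= linear_sum.
      apply: eq_bigr => k _; have [_ _ Tv _] := g k.
      by rewrite /rank_one [in RHS]linearZ /= [in RHS]Tv !scalerA mulrC.
    apply: (@cvg_comp _ _ _ _ T _ _ _ (cvg_span_proj dot_norm v_on (x := x))).
    exact: (bounded_linear_continuous T_bounded).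
  + by apply/bounded_op_rnormP; exists (beta 0%N);
      [exact: rnorm_ge0|exact: TQ_le].
- split=> [x y|x] /=; last by rewrite -linearD addrC subrK.
  (* Moving [T] across leaves [P x] against [T (T (Q y))], which is still orthogonal to each [v j],
     an eigenvector of the self-adjoint [T]. *)
  rewrite (positive_selfadjoint T_positive).
  apply: (span_proj_orth dot_norm v_on) => j.
  have [_ _ Tv _] := g j.
  rewrite !(positive_selfadjoint T_positive) Tv linearZ /= Tv.
  by rewrite scalerA dotZr Qv mulr0.
- apply: ge_sup.
    by exists (rnorm (T (Q 0))); exists 0; rewrite //= rnorm0.
  move=> _ [x [_ x1] <-]; apply: limr_ge => //; apply: nearW => n.
  by rewrite (le_trans (TQ_le n x))// ler_piMr ?rnorm_ge0.
Qed.

End Greedy.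

Theorem theorem3p27 (R : realType) (H : completeNormedModType R[i])
    (dot : {dot H for Num.conj}) (dot_norm : induces_norm dot)
    (T : {linear H -> H}) (T_bounded : bounded_op T)
    (T_positive : positive_op dot T) (T_AN : property_AN T) :
  (~ finite_dimensional H -> AN_representation dot T) /\
  (finite_dimensional H -> AN_representation_findim dot T).
Proof.
have [v vP] := exists_max_eigenvectors dot_norm T_positive T_bounded T_AN.
have [stop|nostop] :=
  pselect (exists n, orth (dot := dot) (mkseq v n) = [set 0]).
- have stopb : exists n, `[< orth (dot := dot) (mkseq v n) = [set 0] >].
    by have [n n0] := stop; exists n; exact/asboolP.
  (* Before the least stage with trivial complement all complements are nonzero, so [vP] applies to
     each earlier [v i]. *)
  case: (ex_minnP stopb) => n /asboolP n0 n_min.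
  have g i : (i < n)%N -> max_eigenvector (dot := dot) T (mkseq v i) (v i).
    move=> i_n; apply: vP => i0.
    by have := n_min i (asboolT i0); rewrite leqNgt i_n.
  by have [fd rep] := AN_representation_findim_of_greedy dot_norm g n0; split.
- have g n : max_eigenvector (dot := dot) T (mkseq v n) (v n).
    by apply: vP => n0; apply: nostop; exists n.
  split=> [_|[d [e e_span]]]; first exact: AN_representation_of_greedy.
  (* An endless process provides [d.+1] orthonormal vectors in a space spanned by [d]. *)
  suff : (d.+1 <= d)%N by rewrite ltnn.
  apply: (@orthonormal_le_dim _ _ dot _ _ (fun i : 'I_d.+1 => v i) e) => // i j.
  by rewrite (greedy_orthonormal dot_norm (g i) (g j)).
Qed.
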